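(* Let $r\in(0,1]$. For any $c\in(0,r)$ there exists a traveling wave with speed equal to $c$ for the geometric flow $\partial_t x_t\cdot\nu_{E_t}(x_t)=-\kappa_r(E_t,x_t)$, $x_t\in\partial E_t$, and the corresponding traveling set is $C^{1,1}$ (i.e. has $C^{1,1}$ boundary) and convex.
   Context: Balls are open. For $E\subset\mathbb{R}^2$ and $x\in\partial E$ near which the boundary is regular enough, let $\nu_E(x)$ be the external unit normal, $\kappa(E,x)$ the curvature of $\partial E$ at $x$ (nonnegative for convex sets), and $B^{\mathrm{ext}}_{r,x}:=B_r(x+r\nu_E(x))$, $B^{\mathrm{int}}_{r,x}:=B_r(x-r\nu_E(x))$. The $r$-curvature is $\kappa_r(E,x):=\kappa_r^+(E,x)+\kappa_r^-(E,x)$, where $\kappa_r^+(E,x):=\frac{\kappa(E,x)}2+\frac1{2r}$ if $B^{\mathrm{ext}}_{r,x}\subseteq\mathbb{R}^2\setminus E$ and $\kappa_r^+(E,x):=0$ otherwise; $\kappa_r^-(E,x):=\frac{\kappa(E,x)}2-\frac1{2r}$ if $B^{\mathrm{int}}_{r,x}\subseteq E$ and $\kappa_r^-(E,x):=0$ otherwise. A traveling wave with speed $c\in\mathbb{R}$ is a solution of the flow in which $E_t$ is of the form $\{(x,y): y>h(x)+ct\}$ for some real function $h$ (defined on an open interval, possibly bounded). Equivalently, $\kappa_r(E_0,(x,h(x)))\,\sqrt{1+|h'(x)|^2}=c$ along the graph of $h$. When the boundary is only $C^{1,1}$, this equation is required at the points where the boundary is $C^2$ near the point, the normal velocity $c/\sqrt{1+|h'(x)|^2}$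 being then defined by continuity at all the points of the boundary. *)

(* Defs.v *)
From mathcomp Require Import all_boot all_order all_algebra.
From mathcomp Require Import all_classical all_reals all_analysis.

Set Implicit Arguments.
Unset Strict Implicit.
Unset Printing Implicit Defensive.

Import Order.TTheory GRing.Theory Num.Theory.
Import numFieldNormedType.Exports.

Local Open Scope classical_set_scope.
Local Open Scope ring_scope.

(* The library norm on a product is the sup norm, hence the explicit Euclidean
   norm and balls below. *)
Notation plane R := (R^o * R^o)%type.

Section Plane.
Context {R : realType}.

Definition dot (u v : plane R) : R := u.1 * v.1 + u.2 * v.2.

Definition enorm (u : plane R) : R := Num.sqrt (dot u u).

Definition eball (r : R) (x : plane R) : set (plane R) :=
  [set q | enorm (q - x) < r].

Definition perp (m : plane R) : plane R := (- m.2, m.1).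

Definition boundary (E : set (plane R)) : set (plane R) := closure E `\` E^°.

(* In the orthonormal frame with origin p and axes perp m (abscissa s) and m
   (ordinate y), E is, near p, the set below the graph of g.  Points of the
   graph itself may or may not belong to E. *)
Definition local_subgraph (E : set (plane R)) (p m : plane R) (g : R -> R) : Prop :=
  [/\ dot m m = 1, g 0 = 0 &
      \forall s \near (0 : R) & y \near (0 : R),
        (y < g s -> E (p + s *: perp m + y *: m)) /\
        (g s < y -> ~ E (p + s *: perp m + y *: m))].

Definition C1_near0 (g : R -> R) : Prop :=
  \forall s \near (0 : R),
    derivable g s 1 /\ {for s, continuous (derive1 g)}.

Definition C2_near0 (g : R -> R) : Prop :=
  \forall s \near (0 : R),
    [/\ derivable g s 1, derivable (derive1 g) s 1 & {for s, continuous (derive1n 2 g)}].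

Definition C11_near0 (g : R -> R) : Prop :=
  exists A : set R, [/\ nbhs (0 : R) A,
    forall s, A s -> derivable g s 1 &
    [lipschitz derive1 g s | s in A]].

Definition C11_boundary (E : set (plane R)) : Prop :=
  forall p, boundary E p ->
    exists m g, local_subgraph E p m g /\ C11_near0 g.

Definition C2_point (E : set (plane R)) (p : plane R) : Prop :=
  exists m g, local_subgraph E p m g /\ C2_near0 g.

(* The external unit normal and the curvature are given by the usual formulas
   for graphs; being geometric quantities, they do not depend on the frame and
   on the function g chosen to represent E near p. *)
Definition is_outer_normal (E : set (plane R)) (p nu : plane R) : Prop :=
  exists m g, [/\ local_subgraph E p m g, C1_near0 g &
    nu = (Num.sqrt (1 + derive1 g 0 ^+ 2))^-1 *: (m - derive1 g 0 *: perp m)].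

(* With this sign the curvature is nonnegative when E is convex, that is, when
   g is concave. *)
Definition is_curvature (E : set (plane R)) (p : plane R) (k : R) : Prop :=
  exists m g, [/\ local_subgraph E p m g, C2_near0 g &
    k = - derive1n 2 g 0 / Num.sqrt (1 + derive1 g 0 ^+ 2) ^+ 3].

Definition ext_ball (r : R) (x nu : plane R) : set (plane R) := eball r (x + r *: nu).

Definition int_ball (r : R) (x nu : plane R) : set (plane R) := eball r (x - r *: nu).

Definition kappa_plus (r : R) (E : set (plane R)) (x nu : plane R) (k : R) : R :=
  if `[< ext_ball r x nu `<=` ~` E >] then k / 2 + 1 / (2 * r) else 0.

Definition kappa_minus (r : R) (E : set (plane R)) (x nu : plane R) (k : R) : R :=
  if `[< int_ball r x nu `<=` E >] then k / 2 - 1 / (2 * r) else 0.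

Definition is_r_curvature (r : R) (E : set (plane R)) (x : plane R) (kr : R) : Prop :=
  exists nu k, [/\ is_outer_normal E x nu, is_curvature E x k &
    kr = kappa_plus r E x nu k + kappa_minus r E x nu k].

Definition boundary_path (E : R -> set (plane R)) (t : R) (p : plane R)
    (x : R -> plane R) : Prop :=
  x t = p /\ \forall s \near t, boundary (E s) (x s).

(* v is the value of (d/dt x_t) . nu for the differentiable paths
   x_s in boundary (E s) with x_t = p; at least one such path exists. *)
Definition is_normal_velocity (E : R -> set (plane R)) (t : R) (p : plane R)
    (v : R) : Prop :=
  exists nu, [/\ is_outer_normal (E t) p nu,
    exists x w, boundary_path E t p x /\ is_derive t 1 x w &
    forall x w, boundary_path E t p x -> is_derive t 1 x w -> v = dot w nu].

(* Solutions of d/dt x_t . nu = - kappa_r whose boundary need not be C^2: the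
   law is imposed at the points near which the boundary is C^2.  These are
   required to be dense in the boundary, so that the continuous function V t is
   determined by its values there. *)
Definition flow_solution (r : R) (E : R -> set (plane R)) : Prop :=
  exists V : R -> plane R -> R, forall t : R,
    [/\ {within boundary (E t), continuous (V t)},
        forall p, boundary (E t) p -> is_normal_velocity E t p (V t p),
        forall p, boundary (E t) p -> C2_point (E t) p ->
          is_r_curvature r (E t) p (- V t p) &
        boundary (E t) `<=` closure (boundary (E t) `&` C2_point (E t))].

(* Only the values of h on I matter. *)
Definition traveling_set (c : R) (I : set R) (h : R -> R) (t : R) : set (plane R) :=
  [set p | I p.1 /\ h p.1 + c * t < p.2].

Definition traveling_wave (r c : R) (I : set R) (h : R -> R) : Prop :=
  [/\ open I, is_interval I, I !=set0 &
      flow_solution r (traveling_set c I h)].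

End Plane.

(* Main.v *)
Require Import Defs.
From mathcomp Require Import all_boot all_order all_algebra.
From mathcomp Require Import all_classical all_reals all_analysis.
From mathcomp Require Import ring lra.
Import Order.TTheory GRing.Theory Num.Theory.
Import numFieldNormedType.Exports.
Local Open Scope classical_set_scope.
Local Open Scope ring_scope.

(** The traveling wave is the grim reaper: the epigraph of
    h x = - ln (cos (c * x)) / c over the interval |c * x| < pi / 2.

    The r-curvature equals the ordinary curvature wherever both tangent balls
    of radius r fit on their sides of the boundary, because the terms
    1 / (2 * r) and - 1 / (2 * r) cancel.  If this happens along the whole
    graph, the equation of the wave becomes h'' = c * (1 + h' ^+ 2), that is
    h' = tan (c * x), whose solution is the grim reaper.  At the point of
    abscissa x put theta = c * x; then h' = tan theta, the outer normal is
    (sin theta, - cos theta), the curvature is c * cos theta, and the normal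
    velocity of the upward translation with speed c is - c * cos theta.

    Both balls do fit.  The exterior one lies below the tangent line, and the
    graph lies above it since h is convex ([ln_cos_le_tangent],
    [ext_ball_traveling_set]).  As for the interior one, the curvature of the
    graph is at most c, and c <= 1 / r because c < r <= 1; hence the ball of
    radius r is contained in the internally tangent ball of radius 1 / c, and
    this larger ball rolls freely inside the epigraph.  After a dilation by c
    the last fact is a statement on unit balls, which is proved by following
    the lower half circle along its angle ([unit_arc_above_grim],
    [unit_ball_above_grim], [int_ball_grim]).

    Since h tends to infinity at both ends of the interval, the closed epigraph
    is closed in the plane and the boundary is exactly the graph
    ([closed_grim], [boundary_traveling_set]).  All of its points are C^2
    points, seen in the frame whose ordinate axis points downwards; this gives
    the C^{1,1} regularity as well as the normal and the curvature.  The normal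
    velocity is obtained by differentiating y = h x + c * s along an arbitrary
    path ([normal_velocity_traveling]). *)

(** * Calculus: minima, and the logarithm of the cosine *)

Section Calculus.
Context {R : realType}.
Implicit Types (f df : R -> R) (a b x y : R).

(** The two points come in either order, as needed for minima and Lipschitz
    bounds on both sides of a point. *)
Lemma mean_value_itv f df a b x y :
    (forall z, a < z < b -> is_derive z 1 f (df z)) ->
    a < x < b -> a < y < b ->
  exists2 z, (x <= z <= y) || (y <= z <= x) & f y - f x = df z * (y - x).
Proof.
move=> dfE; wlog xy : x y / x <= y => [IH xab yab|/andP[ax xb] /andP[ay yb]].
  case/orP: (le_total x y) => xy; first exact: IH.
  have [z zyx fE] := IH _ _ xy yab xab.
  by exists z; [rewrite orbC|rewrite -opprB fE -mulrN opprB].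
have inab z : x <= z <= y -> a < z < b.
  by move=> /andP[xz zy]; rewrite (lt_le_trans ax xz) (le_lt_trans zy yb).
have [||z zxy ->] := @MVT_segment R f df x y xy.
- move=> z; rewrite in_itv/= => /andP[/ltW xz /ltW zy].
  by apply: dfE; rewrite inab// xz.
- apply: derivable_within_continuous => z; rewrite in_itv/= => zxy.
  by have [] := dfE _ (inab _ zxy).
- by exists z => //; rewrite in_itv/= in zxy; rewrite zxy.
Qed.

Lemma is_min_of_derive_sign f df a b x0 x :
    (forall z, a < z < b -> is_derive z 1 f (df z)) ->
    (forall z, a < z < b -> x0 <= z -> 0 <= df z) ->
    (forall z, a < z < b -> z <= x0 -> df z <= 0) ->
    a < x0 < b -> a < x < b -> f x0 <= f x.
Proof.
move=> dfE df_ge0 df_le0 x0ab xab; rewrite -subr_ge0.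
have [z zx ->] := mean_value_itv f df a b x0 x dfE x0ab xab.
case/andP: x0ab => ax0 x0b; case/andP: xab => ax xb.
case/orP: zx => /andP[le1 le2].
  by rewrite mulr_ge0 ?subr_ge0 ?(le_trans le1)// df_ge0//; apply/andP; split; lra.
rewrite mulr_le0 ?subr_le0 ?(le_trans le1)// df_le0//; apply/andP; split; lra.
Qed.

Lemma ler_sinB x y : x <= y -> sin y - sin x <= y - x.
Proof.
move=> xy; have dsin z : x - 1 < z < y + 1 -> is_derive z 1 (@sin R) (cos z).
  by move=> _; exact: is_derive_sin.
have [||z _ ->] := mean_value_itv _ _ _ _ x y dsin; try by apply/andP; split; lra.
by rewrite ler_piMl ?cos_le1// subr_ge0.
Qed.

Definition acute (x : R) : bool := - (pi / 2) < x < pi / 2.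

Lemma acute_cos_gt0 x : acute x -> 0 < cos x.
Proof. exact: cos_gt0_pihalf. Qed.

Lemma acute_cos_neq0 x : acute x -> cos x != 0.
Proof. by move/acute_cos_gt0/lt0r_neq0. Qed.

Lemma acute_le_tan x y : acute x -> acute y -> x <= y -> tan x <= tan y.
Proof.
by move=> ax ay; rewrite !le_eqVlt => /orP[/eqP->|xy]; rewrite ?eqxx// ltr_tan ?xy ?orbT.
Qed.

Lemma is_derive_ln_cos x : acute x -> is_derive x 1 (fun u => ln (cos u)) (- tan x).
Proof.
move=> /acute_cos_gt0 cx.
have dln := is_derive1_ln cx.
suff -> : - tan x = (cos x)^-1 * - sin x by exact: (is_derive1_comp dln).
by rewrite mulrN mulrC.
Qed.

Lemma ln_cos_le_tangent x y : acute x -> acute y ->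
  ln (cos y) <= ln (cos x) - tan x * (y - x).
Proof.
move=> ax ay; pose f u := - tan x * u - ln (cos u).
suff : f x <= f y by rewrite /f mulrBr; lra.
apply: (is_min_of_derive_sign f (fun u => - tan x * 1 - - tan u) _ _ x y _ _ _ ax ay)
  => z az.
- have dz := is_derive_ln_cos z az.
  by apply: is_deriveB.
- by move=> /(acute_le_tan _ _ ax az); lra.
- by move=> /(acute_le_tan _ _ az ax); lra.
Qed.

Lemma acute_le_sin x y : acute x -> acute y -> x <= y -> sin x <= sin y.
Proof.
move=> /andP[/ltW ? /ltW ?] /andP[/ltW ? /ltW ?]; rewrite !le_eqVlt => /orP[/eqP->|xy].
  by rewrite eqxx.
by rewrite ltr_sin ?xy ?orbT// in_itv/=; apply/andP.
Qed.

(** The unit circle that touches the curve - ln (cos _) from above at abscissa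
    [x] stays above it: the point of angle [y] of its lower half has abscissa
    [w y] and ordinate - ln (cos x) + cos x - cos y.  The derivative in [y] of
    the gap between circle and curve is sin y - tan (w y) * cos y, which has the
    sign of tan y - tan (w y).  As sin is 1-Lipschitz and increasing, [w y] lies
    between [x] and [y], so that the gap is smallest at the contact point
    y = x. *)
Lemma unit_arc_above_grim x y (w := fun u => x + (sin u - sin x)) : acute x -> acute y ->
  acute (w y) /\ ln (cos x) - cos x <= ln (cos (w y)) - cos y.
Proof.
move=> ax ay.
have w_ge u : acute u -> x <= u -> x <= w u <= u.
  move=> au xu; have := acute_le_sin _ _ ax au xu; have := ler_sinB _ _ xu.
  by rewrite /w => ? ?; apply/andP; split; lra.
have w_le u : acute u -> u <= x -> u <= w u <= x.
  move=> au ux; have := acute_le_sin _ _ au ax ux; have := ler_sinB _ _ ux.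
  by rewrite /w => ? ?; apply/andP; split; lra.
have aw u : acute u -> acute (w u).
  move=> au; case/andP: (ax) => x1 x2; case/andP: (au) => u1 u2.
  case/orP: (le_total x u) => [xu|ux]; [case/andP: (w_ge _ au xu)|case/andP: (w_le _ au ux)];
    by move=> w1 w2; apply/andP; split; lra.
split; first exact: aw.
pose f u := ln (cos (w u)) - cos u.
pose df u := - tan (w u) * cos u - - sin u.
have tan_cos u : acute u -> sin u = tan u * cos u.
  by move=> au; rewrite /tan divfK// acute_cos_neq0.
have -> : ln (cos x) - cos x = f x by rewrite /f /w subrr addr0.
apply: (is_min_of_derive_sign f df _ _ x y _ _ _ ax ay) => u au.
- have dw : is_derive u 1 w (cos u).
    have -> : cos u = 0 + (cos u - 0) by rewrite add0r subr0.
    by apply: is_deriveD; apply: is_deriveB.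
  have dl := is_derive_ln_cos _ (aw _ au).
  have dc : is_derive u 1 (fun u => ln (cos (w u))) (- tan (w u) * cos u).
    exact: (is_derive1_comp dl).
  exact: is_deriveB.
- move=> xu; rewrite /df opprK (tan_cos u au) -mulrDl mulr_ge0//; last first.
    by rewrite ltW// acute_cos_gt0.
  rewrite addrC subr_ge0 acute_le_tan//; first exact: aw.
  by case/andP: (w_ge u au xu).
- move=> ux; rewrite /df opprK (tan_cos u au) -mulrDl mulr_le0_ge0//; last first.
    by rewrite ltW// acute_cos_gt0.
  rewrite addrC subr_le0 acute_le_tan//; first exact: aw.
  by case/andP: (w_le u au ux).
Qed.

(** Here (u, v) is the displacement from the contact point; the condition says
    that it leads into the open unit ball.  Each point of the ball lies
    above a point of the lower half circle, of angle [y]. *)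
Lemma unit_ball_above_grim x u v : acute x -> (u + sin x) ^+ 2 + (v - cos x) ^+ 2 < 1 ->
  acute (x + u) /\ ln (cos x) - v < ln (cos (x + u)).
Proof.
move=> ax uv1; pose y := asin (u + sin x).
have /andP[s1 s2] : -1 < u + sin x < 1.
  rewrite -ltr_norml -(@ltr_pXn2r _ 2)// ?nnegrE// expr1n real_normK ?num_real//.
  by apply: le_lt_trans uv1; rewrite lerDl sqr_ge0.
have siny : sin y = u + sin x by rewrite asinK// in_itv/= !ltW.
have ay : acute y by rewrite /acute asin_gtNpi2 ?s1 ?ltW// asin_ltpi2 ?ltW.
have [] := unit_arc_above_grim x y ax ay; rewrite siny addrK => axu le_min; split => //.
suff : - cos y < v - cos x by lra.
suff /ltr_normlP[] : `|v - cos x| < cos y by lra.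
have cy := acute_cos_gt0 _ ay.
rewrite -(@ltr_pXn2r _ 2)// ?nnegrE ?ltW// real_normK ?num_real//.
by rewrite cos2sin2 siny; lra.
Qed.

End Calculus.

(** * Epigraphs of C^2 functions: frames, normal and curvature *)

Section Graph.
Context {R : realType}.
Variables (I : set R) (h h1 h2 : R -> R).
Hypothesis oI : open I.
Hypothesis dh : forall x, I x -> is_derive x 1 h (h1 x).
Hypothesis dh1 : forall x, I x -> is_derive x 1 h1 (h2 x).
Hypothesis ch2 : forall x, I x -> {for x, continuous h2}.

(** The function that represents the epigraph of [f] near the point of abscissa
    [x] in the frame with m = (0, -1) and perp m = (1, 0): there the set
    lies below the graph, as the definition of a local subgraph requires. *)
Definition drop_profile (f : R -> R) (x s : R) : R := f x - f (x + s).

Lemma near_shift x s : I (x + s) -> \forall u \near s, I (x + u).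
Proof.
move=> Ixs; have : {for s, continuous (fun u : R => x + u)}.
  by apply: cvgD; [exact: cvg_cst|exact: cvg_id].
by apply; exact: open_nbhs_nbhs.
Qed.

Lemma is_derive_translate (f : R -> R) (x s df : R) :
  is_derive (x + s) 1 f df -> is_derive s 1 (fun u => f (x + u)) df.
Proof.
move=> dfx; have dx : is_derive s 1 (fun u : R => x + u) 1.
  by rewrite -[X in is_derive _ _ _ X]add0r; exact: is_deriveD.
rewrite -[df]mulr1; exact: (@is_derive1_comp _ f (fun u : R => x + u)).
Qed.

Lemma is_derive_drop_profile x s : I (x + s) ->
  is_derive s 1 (drop_profile h x) (- h1 (x + s)).
Proof.
move=> Ixs; rewrite -[X in is_derive _ _ _ X]add0r.
by apply: is_deriveB; apply: is_derive_translate; exact: dh.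
Qed.

Lemma drop_profile'E x s : I (x + s) -> derive1 (drop_profile h x) s = - h1 (x + s).
Proof. by move=> Ixs; rewrite derive1E; have [] := is_derive_drop_profile x s Ixs. Qed.

Lemma is_derive_drop_profile' x s : I (x + s) ->
  is_derive s 1 (derive1 (drop_profile h x)) (- h2 (x + s)).
Proof.
move=> Ixs; apply: (@near_eq_is_derive _ _ _ (fun u => - h1 (x + u))).
  by near=> u; rewrite drop_profile'E//; near: u; exact: near_shift.
by apply: is_deriveN; apply: is_derive_translate; exact: dh1.
Unshelve. all: by end_near. Qed.

Lemma drop_profile''E x s : I (x + s) -> derive1n 2 (drop_profile h x) s = - h2 (x + s).
Proof.
move=> Ixs; rewrite derive1nS derive1n1 derive1E.
by have [] := is_derive_drop_profile' x s Ixs.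
Qed.

Lemma continuous_translate (f : R -> R) x s :
  {for x + s, continuous f} -> {for s, continuous (fun u => f (x + u))}.
Proof.
move=> cf; apply: (@continuous_comp _ _ _ (fun u => x + u) f) => //.
by apply: cvgD; [exact: cvg_cst|exact: cvg_id].
Qed.

Lemma continuous_drop_profile'' x s : I (x + s) ->
  {for s, continuous (derive1n 2 (drop_profile h x))}.
Proof.
move=> Ixs; rewrite /prop_for /continuous_at drop_profile''E//.
apply: cvg_trans (_ : (fun u => - h2 (x + u)) @ s --> _).
  apply: near_eq_cvg; near=> u; rewrite drop_profile''E//.
  by near: u; exact: near_shift.
by apply: cvgN; apply: continuous_translate; exact: ch2.
Unshelve. all: by end_near. Qed.

Lemma C2_drop_profile x : I x -> C2_near0 (drop_profile h x).
Proof.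
move=> Ix; have /near_shift : I (x + 0) by rewrite addr0.
apply: filterS => s Ixs; split; last exact: continuous_drop_profile''.
- by have [] := is_derive_drop_profile _ _ Ixs.
- by have [] := is_derive_drop_profile' _ _ Ixs.
Qed.

Lemma C1_drop_profile x : I x -> C1_near0 (drop_profile h x).
Proof.
move=> Ix; have /near_shift : I (x + 0) by rewrite addr0.
apply: filterS => s Ixs; have [d1 _] := is_derive_drop_profile _ _ Ixs; split => //.
have [d2 _] := is_derive_drop_profile' _ _ Ixs.
exact/differentiable_continuous/derivable1_diffP.
Qed.

(** The second derivative, being continuous, is bounded near 0, and bounds the
    Lipschitz constant of the first one. *)
Lemma C11_drop_profile x : I x -> C11_near0 (drop_profile h x).
Proof.
move=> Ix; have Ix0 : I (x + 0) by rewrite addr0.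
have cg := continuous_drop_profile'' _ _ Ix0.
have [M gM] : exists M, \forall s \near (0 : R), `|derive1n 2 (drop_profile h x) s| <= M.
  exists (`|derive1n 2 (drop_profile h x) 0| + 1).
  move/cvgr_norm_le : cg; apply; lra.
have : \forall s \near (0 : R), I (x + s) /\ `|derive1n 2 (drop_profile h x) s| <= M.
  by apply: filterI => //; exact: near_shift.
move=> /nbhs_ballP[e /= e0 eP].
have beP s : ball (0 : R) e s <-> - e < s < e.
  by rewrite /ball/= sub0r normrN ltr_norml.
exists (ball 0 e); split; first exact: nbhsx_ballx.
  by move=> s /eP[Ixs _]; have [] := is_derive_drop_profile _ _ Ixs.
exists `|M|; split; [exact: num_real|move=> L ML [s u] [/= es eu] /=].
have dg z : - e < z < e ->
    is_derive z 1 (derive1 (drop_profile h x)) (derive1n 2 (drop_profile h x) z).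
  move=> /beP bz.
  have [Ixz _] := eP _ bz.
  rewrite (drop_profile''E _ _ Ixz).
  exact: is_derive_drop_profile'.
move/beP : es => es; move/beP : eu => eu.
have [z zsu ->] := mean_value_itv _ _ _ _ _ _ dg eu es.
rewrite normrM ler_wpM2r// (@le_trans _ _ M)//; last first.
  exact/ltW/(le_lt_trans _ ML)/ler_norm.
suff /beP/eP[] : - e < z < e by [].
case/andP: es => ? ?; case/andP: eu => ? ?.
by case/orP: zsu => /andP[? ?]; apply/andP; split; lra.
Qed.

Lemma local_subgraph_epigraph (c t : R) (p : plane R) : I p.1 -> p.2 = h p.1 + c * t ->
  local_subgraph (traveling_set c I h t) p (0, -1) (drop_profile h p.1).
Proof.
move=> Ip pE; split; first by rewrite /dot/=; ring.
  by rewrite /drop_profile addr0 subrr.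
have Ip0 : I (p.1 + 0) by rewrite addr0.
near=> s y.
have Is : I (p.1 + s) by near: s; apply: near_shift.
rewrite /traveling_set/= /drop_profile /= pE.
have -> : p.1 + s *: (- -1 : R) + y *: (0 : R) = p.1 + s.
  by rewrite opprK scaler0 addr0 /GRing.scale/= mulr1.
have -> : h p.1 + c * t + s *: (0 : R) + y *: (-1 : R) = h p.1 + c * t - y.
  by rewrite scaler0 addr0 scalerN /GRing.scale/= mulr1.
by split=> [ys|ys [_]]; [split=> //|]; lra.
Unshelve. all: by end_near. Qed.

Lemma outer_normal_epigraph (c t : R) (p : plane R) : I p.1 -> p.2 = h p.1 + c * t ->
  is_outer_normal (traveling_set c I h t) p
    ((Num.sqrt (1 + h1 p.1 ^+ 2))^-1 *: ((h1 p.1, -1) : plane R)).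
Proof.
move=> Ip pE; exists (0, -1), (drop_profile h p.1); split.
- exact: local_subgraph_epigraph.
- exact: C1_drop_profile.
rewrite drop_profile'E ?addr0// sqrrN; congr (_ *: _).
by congr pair; rewrite /= /GRing.scale/=; ring.
Qed.

Lemma curvature_epigraph (c t : R) (p : plane R) : I p.1 -> p.2 = h p.1 + c * t ->
  is_curvature (traveling_set c I h t) p (h2 p.1 / Num.sqrt (1 + h1 p.1 ^+ 2) ^+ 3).
Proof.
move=> Ip pE; exists (0, -1), (drop_profile h p.1); split.
- exact: local_subgraph_epigraph.
- exact: C2_drop_profile.
by rewrite drop_profile'E ?drop_profile''E ?addr0// sqrrN opprK.
Qed.

End Graph.

(** * Boundary and normal velocity of a translating epigraph *)

Section Epigraph.
Context {R : realType}.
Variables (c : R) (I : set R) (h : R -> R).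
Hypothesis oI : open I.
Hypothesis ch : forall x, I x -> {for x, continuous h}.

Definition traveling_graph (t : R) : set (plane R) :=
  [set p | I p.1 /\ p.2 = h p.1 + c * t].

Lemma open_traveling_set t : open (traveling_set c I h t).
Proof.
rewrite openE => p [Ip hp]; rewrite /interior.
have c1 : (fun q : plane R => q.1) @ p --> p.1 by exact: cvg_fst.
have c2 : (fun q : plane R => q.2) @ p --> p.2 by exact: cvg_snd.
have ch1 : (fun q : plane R => q.2 - (h q.1 + c * t)) @ p --> p.2 - (h p.1 + c * t).
  apply: cvgB => //; apply: cvgD; last exact: cvg_cst.
  exact: (cvg_comp _ _ c1 (ch _ Ip)).
have n1 : \forall q \near p, I q.1 by apply: c1; exact: open_nbhs_nbhs.
have n2 : \forall q \near p, 0 < q.2 - (h q.1 + c * t).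
  by move/cvgr_gt : ch1; apply; rewrite subr_gt0.
by near=> q; split; [near: q|rewrite -subr_gt0; near: q].
Unshelve. all: by end_near. Qed.

(** Closedness of the closed epigraph excludes boundary points above the
    endpoints of [I]. *)
Lemma boundary_traveling_set t :
    closed [set p : plane R | I p.1 /\ h p.1 <= p.2] ->
  boundary (traveling_set c I h t) = traveling_graph t.
Proof.
move=> cF; apply/seteqP; split => [p [clp nip]|p [Ip pE]].
  have cFt : closed [set p : plane R | I p.1 /\ h p.1 + c * t <= p.2].
    (* translation to the epigraph at time 0 *)
    pose down (p : plane R) : plane R := (p.1, p.2 - c * t).
    have -> : [set p : plane R | I p.1 /\ h p.1 + c * t <= p.2]
        = down @^-1` [set p : plane R | I p.1 /\ h p.1 <= p.2].
      by apply/seteqP; split => q /=; rewrite lerBrDr.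
    apply: preimage_closed => // q _.
    have c1 : (fun q : plane R => q.1) @ q --> q.1 by exact: cvg_fst.
    have c2 : (fun q : plane R => q.2 - c * t) @ q --> q.2 - c * t.
      by apply: cvgB; [exact: cvg_snd|exact: cvg_cst].
    exact: (cvg_pair c1 c2).
  have [Ip hp] : [set p : plane R | I p.1 /\ h p.1 + c * t <= p.2] p.
    by apply: cFt; move: clp; apply: closureS => q [Iq /ltW].
  split => //; apply/eqP; rewrite eq_le hp andbT leNgt; apply/negP => lt_hp.
  by apply: nip; apply: open_traveling_set.
split => [B [[B1 B2] /= [B1p B2p] BB]|/interior_subset[_]].
  have : \forall y \near p.2^'+, B2 y by apply: filterS B2p.
  move=> near_B2; near p.2^'+ => y.
  exists (p.1, y); split; first split => //=; last first.
    apply: BB; split => /=; first exact: nbhs_singleton.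
    by near: y.
  by rewrite -pE; near: y; exact: nbhs_right_gt.
by rewrite pE ltxx.
Unshelve. all: by end_near. Qed.

End Epigraph.

Section Velocity.
Context {R : realType}.

Lemma is_derive_fst (x : R -> plane R) (t : R) (w : plane R) :
  is_derive t 1 x w -> is_derive t 1 (fun s => (x s).1) w.1.
Proof.
move=> dx.
have H : (fun k : R => k^-1 *: (((fun s => (x s).1) \o shift t) (k *: 1) - (x t).1)) @ 0^'
    --> w.1.
  have [/cvg_ex[l xl] lw] := dx.
  have -> : w = l by rewrite -lw; exact: (cvg_lim _ xl).
  exact: (cvg_comp _ _ xl (@cvg_fst _ _ _ _ _)).
by apply: DeriveDef; [apply/cvg_ex; exists w.1|exact: (cvg_lim _ H)].
Qed.

Lemma is_derive_snd (x : R -> plane R) (t : R) (w : plane R) :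
  is_derive t 1 x w -> is_derive t 1 (fun s => (x s).2) w.2.
Proof.
move=> dx.
have H : (fun k : R => k^-1 *: (((fun s => (x s).2) \o shift t) (k *: 1) - (x t).2)) @ 0^'
    --> w.2.
  have [/cvg_ex[l xl] lw] := dx.
  have -> : w = l by rewrite -lw; exact: (cvg_lim _ xl).
  exact: (cvg_comp _ _ xl (@cvg_snd _ _ _ _ _)).
by apply: DeriveDef; [apply/cvg_ex; exists w.2|exact: (cvg_lim _ H)].
Qed.

Lemma is_derive_line (p v : plane R) (t : R) :
  is_derive t 1 (fun s : R => p + (s - t) *: v) v.
Proof.
suff H : (fun k : R => k^-1 *: (((fun s : R => p + (s - t) *: v) \o shift t) (k *: 1)
    - (p + (t - t) *: v))) @ 0^' --> v.
  by apply: DeriveDef; [apply/cvg_ex; exists v|exact: (cvg_lim _ H)].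
apply: cvg_trans (_ : (fun=> v) @ (0 : R)^' --> v); last exact: cvg_cst.
apply: near_eq_cvg; near=> k.
have k0 : k != 0 by near: k; exact: nbhs_dnbhs_neq.
rewrite /= subrr scale0r addr0 addrAC subrr add0r addrK.
by rewrite [k *: 1]mulr1 scalerA mulVf// scale1r.
Unshelve. all: by end_near. Qed.

(** A path (x1, x2) on the moving graph satisfies x2 = h x1 + c * s, hence
    x2' = h1 x1 * x1' + c.  A normal vector [nu] is orthogonal to the tangent
    vector (1, h1 x1), and only the part (0, c) of the velocity contributes.
    The vertical translation of [p] provides a path. *)
Lemma normal_velocity_traveling (c : R) (I : set R) (h h1 : R -> R) (t : R) (p nu : plane R) :
    (forall s, boundary (traveling_set c I h s) = traveling_graph c I h s) ->
    I p.1 -> p.2 = h p.1 + c * t -> is_derive p.1 1 h (h1 p.1) ->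
    nu.1 = - h1 p.1 * nu.2 -> is_outer_normal (traveling_set c I h t) p nu ->
  is_normal_velocity (traveling_set c I h) t p (c * nu.2).
Proof.
move=> bE Ip pE dh nuE nup; exists nu; split => //.
  exists (fun s => p + (s - t) *: ((0, c) : plane R)), (0, c); split; last first.
    exact: is_derive_line.
  split; first by rewrite subrr scale0r addr0.
  near=> s; rewrite bE; rewrite /traveling_graph /=.
  by rewrite scaler0 addr0 pE; split=> //; rewrite /GRing.scale/=; ring.
move=> x w [xt bx] dx.
have d1 := is_derive_fst _ _ _ dx; have d2 := is_derive_snd _ _ _ dx.
have : is_derive t 1 (fun s => (x s).2) (h1 p.1 * w.1 + c).
  apply: (@near_eq_is_derive _ _ _ (fun s => h (x s).1 + c * s)).
    by apply: filterS bx => s; rewrite bE => -[].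
  apply: is_deriveD.
    by apply: (@is_derive1_comp _ h (fun s => (x s).1)); rewrite xt.
  rewrite -[X in is_derive _ _ _ X]mulr1; exact: is_deriveZ.
move=> [_]; have [_ ->] := d2 => w2.
rewrite /dot nuE w2; ring.
Unshelve. all: by end_near. Qed.

End Velocity.

(** * Epigraphs of functions lying above their tangents *)

Section Convex.
Context {R : realType}.

Lemma eballE (r : R) (x q : plane R) : 0 < r ->
  eball r x q <-> (q.1 - x.1) ^+ 2 + (q.2 - x.2) ^+ 2 < r ^+ 2.
Proof.
move=> r0; rewrite /eball/= /enorm /dot/= -!expr2.
set d := _ + _; have d0 : 0 <= d by rewrite addr_ge0 ?sqr_ge0.
by rewrite -(@ltr_pXn2r _ 2)// ?nnegrE ?sqrtr_ge0 ?ltW// sqr_sqrtr.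
Qed.

Variables (c : R) (I : set R) (h h1 : R -> R).
Hypothesis tangent : forall x y, I x -> I y -> h x + h1 x * (y - x) <= h y.

(** Weighting the tangent inequalities at the intermediate abscissa [z] makes the
    slopes cancel. *)
Lemma convex_traveling_set t : is_interval I ->
  convex_set (traveling_set c I h t : set (convex_lmodType (plane R))).
Proof.
move=> itvI p q l /set_mem[Ip hp] /set_mem[Iq hq]; apply/mem_set.
have [a0 a1] : 0 <= l%:num /\ l%:num <= 1 by split; [exact: ge0|exact: le1].
set a := l%:num in a0 a1.
pose z := a * p.1 + (1 - a) * q.1.
change (I z /\ h z + c * t < a * p.2 + (1 - a) * q.2).
have Iz : I z.
  case/orP: (le_total p.1 q.1) => pq.
    by apply: (itvI _ _ Ip Iq); apply/andP; split; rewrite /z; nra.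
  by apply: (itvI _ _ Iq Ip); apply/andP; split; rewrite /z; nra.
split => //.
have hzp := tangent _ _ Iz Ip; have hzq := tangent _ _ Iz Iq.
have hz : h z <= a * h p.1 + (1 - a) * h q.1.
  have -> : h z = a * (h z + h1 z * (p.1 - z)) + (1 - a) * (h z + h1 z * (q.1 - z)).
    by rewrite /z; ring.
  by apply: lerD; apply: ler_wpM2l; rewrite ?subr_ge0.
apply: le_lt_trans (_ : a * (h p.1 + c * t) + (1 - a) * (h q.1 + c * t) < _).
  by rewrite -subr_ge0; move: hz; rewrite -subr_ge0; congr (0 <= _); ring.
have [a00|an0] := eqVneq a 0; first by rewrite a00 subr0 !mul0r !add0r !mul1r.
apply: ltr_leD; first by rewrite ltr_pM2l// lt_neqAle eq_sym an0.
by rewrite ler_wpM2l ?subr_ge0// ltW.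
Qed.

(** Every point of the exterior ball has a positive component along [nu], hence
    lies below the tangent line. *)
Lemma ext_ball_traveling_set r t (p nu : plane R) : 0 < r ->
    I p.1 -> p.2 = h p.1 + c * t ->
    nu.1 = - h1 p.1 * nu.2 -> nu.2 < 0 -> dot nu nu = 1 ->
  ext_ball r p nu `<=` ~` traveling_set c I h t.
Proof.
move=> r0 Ip pE nuE nu2 nu1 q /(eballE _ _ _ r0) /= + [Iq hq].
rewrite /GRing.scale/=.
have := tangent _ _ Ip Iq.
set a := q.1 - p.1 => tq.
have -> : q.1 - (p.1 + r * nu.1) = a - r * nu.1 by rewrite /a; ring.
have bE : h1 p.1 * a < q.2 - p.2 by rewrite pE; lra.
set b := q.2 - p.2 in bE.
have -> : q.2 - (p.2 + r * nu.2) = b - r * nu.2 by rewrite /b; ring.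
have -> : (a - r * nu.1) ^+ 2 + (b - r * nu.2) ^+ 2 =
   a ^+ 2 + b ^+ 2 + 2 * (r * (nu.2 * (h1 p.1 * a - b))) + r ^+ 2 * dot nu nu.
  by rewrite /dot nuE; ring.
rewrite nu1 mulr1 -ltrBrDr subrr ltNge => /negP; apply.
have : 0 <= r * (nu.2 * (h1 p.1 * a - b)).
  by rewrite mulr_ge0 ?(ltW r0)// nmulr_rge0// subr_le0 ltW.
by have := sqr_ge0 a; have := sqr_ge0 b; lra.
Qed.

End Convex.

(** * The grim reaper *)

Section GrimReaper.
Context {R : realType}.
Variables (r c : R).
Hypotheses (r_gt0 : 0 < r) (c_gt0 : 0 < c) (cr_le1 : c * r <= 1).

Let c_neq0 : c != 0. Proof. exact: lt0r_neq0. Qed.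

Definition strip : set R := [set x | acute (c * x)].
Definition grim (x : R) : R := - ln (cos (c * x)) / c.

Let slope (x : R) : R := tan (c * x).
Let bend (x : R) : R := c * (1 + slope x ^+ 2).
Let normal (x : R) : plane R := (sin (c * x), - cos (c * x)).

Let is_derive_dilation (x : R) : is_derive x 1 (fun u : R => c * u) c.
Proof. rewrite -[X in is_derive _ _ _ X]mulr1; exact: is_deriveZ. Qed.

Let continuous_dilation : continuous (fun u : R => c * u).
Proof. by move=> x; exact: mulrl_continuous. Qed.

Lemma strip_itv : strip = `]- (pi / 2) / c, (pi / 2) / c[%classic.
Proof.
by apply/seteqP; split => x; rewrite /strip/= in_itv/= /acute
  (ltr_pdivrMr _ _ c_gt0) (ltr_pdivlMr _ _ c_gt0) (mulrC x).
Qed.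

Lemma open_strip : open strip.
Proof. by rewrite strip_itv; exact: itv_open. Qed.

Lemma is_interval_strip : is_interval strip.
Proof. by rewrite strip_itv; exact: interval_is_interval. Qed.

Lemma is_derive_grim x : strip x -> is_derive x 1 grim (slope x).
Proof.
move=> sx; have dl := is_derive_ln_cos _ sx.
have dlc : is_derive x 1 (fun u => ln (cos (c * u))) (- tan (c * x) * c).
  exact: (is_derive1_comp dl).
have -> : grim = (fun u => - c^-1 * ln (cos (c * u))).
  by apply/funext => u; rewrite /grim mulNr mulrC mulNr.
have -> : slope x = - c^-1 * (- tan (c * x) * c) by rewrite /slope; field.
exact: is_deriveZ.
Qed.

Lemma is_derive_slope x : strip x -> is_derive x 1 slope (bend x).
Proof.
move=> sx; have dt := is_derive_tan (acute_cos_neq0 _ sx).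
rewrite /bend /slope -cos2_tan2 ?acute_cos_neq0// mulrC.
exact: (is_derive1_comp dt).
Qed.

Lemma continuous_bend x : strip x -> {for x, continuous bend}.
Proof.
move=> sx; have [dsl _] := is_derive_slope x sx.
have cs : {for x, continuous slope}.
  exact/differentiable_continuous/derivable1_diffP.
apply: cvgM; first exact: cvg_cst.
by apply: cvgD; [exact: cvg_cst|exact: (cvgM cs cs)].
Qed.

(** In exponential form the condition reads expR (- c * y) <= cos (c * x) with
    |c * x| <= pi / 2, which is closed; the endpoints satisfy no such inequality
    because the cosine vanishes there. *)
Lemma closed_grim : closed [set p : plane R | strip p.1 /\ grim p.1 <= p.2].
Proof.
have -> : [set p : plane R | strip p.1 /\ grim p.1 <= p.2] =
    (fun p : plane R => c * p.1) @^-1` `[- (pi / 2), pi / 2]%classic `&`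
    (fun p : plane R => cos (c * p.1) - expR (- (c * p.2))) @^-1` `[0, +oo[%classic.
  apply/seteqP; split => p; rewrite /= !in_itv/= andbT subr_ge0.
    move=> [sp gp]; have cp := acute_cos_gt0 _ sp.
    split; first by case/andP: sp => /ltW -> /ltW ->.
    rewrite -[leRHS]lnK ?posrE// ler_expR.
    by move: gp; rewrite /grim ler_pdivrMr// (mulrC p.2); lra.
  move=> [/andP[p1 p2] ep].
  have cp : 0 < cos (c * p.1) by apply: lt_le_trans ep; exact: expR_gt0.
  have sp : strip p.1.
    rewrite /strip/= /acute !lt_neqAle p1 p2 !andbT; apply/andP; split.
      by apply: contraTneq cp => <-; rewrite cosN cos_pihalf ltxx.
    by apply: contraTneq cp => ->; rewrite cos_pihalf ltxx.
  split => //; rewrite /grim ler_pdivrMr// (mulrC p.2).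
  by move: ep; rewrite -[leRHS]lnK ?posrE// ler_expR; lra.
have c1 : continuous (fun p : plane R => c * p.1).
  by move=> p; apply: (cvg_comp _ _ (@cvg_fst _ _ _ _ _)); exact: continuous_dilation.
have c2 : continuous (fun p : plane R => c * p.2).
  by move=> p; apply: (cvg_comp _ _ (@cvg_snd _ _ _ _ _)); exact: continuous_dilation.
apply: closedI; (apply: preimage_closed; last exact: interval_closed) => p _.
  exact: c1.
apply: cvgB.
  by apply: (cvg_comp _ _ (c1 p)); exact: continuous_cos.
by apply: (cvg_comp _ _ (cvgN (c2 p))); exact: continuous_expR.
Qed.

Lemma grim_tangent x y : strip x -> strip y -> grim x + slope x * (y - x) <= grim y.
Proof.
move=> sx sy; have lnc := ln_cos_le_tangent _ _ sx sy.
rewrite /grim /slope -(ler_pM2r c_gt0) mulrDl !divfK//.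
have -> : tan (c * x) * (y - x) * c = tan (c * x) * (c * y - c * x) by ring.
lra.
Qed.

Lemma sqrt_slope x : strip x -> Num.sqrt (1 + slope x ^+ 2) = (cos (c * x))^-1.
Proof.
move=> sx; have cx := acute_cos_gt0 _ sx.
by rewrite -cos2_tan2 ?lt0r_neq0// -exprVn sqrtr_sqr ger0_norm// invr_ge0 ltW.
Qed.

Lemma sin_slope x : strip x -> sin (c * x) = slope x * cos (c * x).
Proof. by move=> sx; rewrite /slope /tan divfK// acute_cos_neq0. Qed.

Let onGraph t := traveling_graph c strip grim t.

Lemma outer_normal_grim t p : onGraph t p ->
  is_outer_normal (traveling_set c strip grim t) p (normal p.1).
Proof.
move=> [sp pE].
have -> : normal p.1 =
    (Num.sqrt (1 + slope p.1 ^+ 2))^-1 *: ((slope p.1, -1) : plane R).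
  rewrite sqrt_slope// invrK /normal sin_slope//.
  by congr pair; rewrite /= /GRing.scale/=; ring.
exact: (outer_normal_epigraph strip grim slope bend open_strip is_derive_grim is_derive_slope).
Qed.

Lemma curvature_grim t p : onGraph t p ->
  is_curvature (traveling_set c strip grim t) p (c * cos (c * p.1)).
Proof.
move=> [sp pE]; have cp := acute_cos_neq0 _ sp.
have -> : c * cos (c * p.1) = bend p.1 / Num.sqrt (1 + slope p.1 ^+ 2) ^+ 3.
  by rewrite sqrt_slope// /bend /slope -cos2_tan2//; field.
exact: (curvature_epigraph strip grim slope bend open_strip is_derive_grim is_derive_slope
  continuous_bend).
Qed.

(** The displacement (a, b) from [p] into the ball of radius [r], multiplied by
    [c], leads into a tangent unit ball because c * r <= 1. *)
Lemma int_ball_grim t p : onGraph t p ->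
  int_ball r p (normal p.1) `<=` traveling_set c strip grim t.
Proof.
move=> [sp pE] q /(eballE _ _ _ r_gt0) /=.
rewrite /GRing.scale/=; set a := q.1 - p.1; set b := q.2 - p.2.
have -> : q.1 - (p.1 - r * sin (c * p.1)) = a + r * sin (c * p.1) by rewrite /a; ring.
have -> : q.2 - (p.2 - r * - cos (c * p.1)) = b - r * cos (c * p.1) by rewrite /b; ring.
(* the component of (a, b) along the outer normal, negative in the ball *)
set D := a * sin (c * p.1) - b * cos (c * p.1).
have sc := cos2Dsin2 (c * p.1) => ball_r.
have ab : a ^+ 2 + b ^+ 2 + 2 * (r * D) < 0.
  suff : r ^+ 2 * (cos (c * p.1) ^+ 2 + sin (c * p.1) ^+ 2) +
     (a ^+ 2 + b ^+ 2 + 2 * (r * D)) < r ^+ 2 by rewrite sc; lra.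
  by apply: le_lt_trans ball_r; rewrite le_eqVlt; apply/orP; left; apply/eqP; rewrite /D; ring.
have D0 : D < 0.
  rewrite -(pmulr_rlt0 _ r_gt0); have := sqr_ge0 a; have := sqr_ge0 b; lra.
have [|aq lnq] := unit_ball_above_grim (c * p.1) (c * a) (c * b) sp.
  have -> : (c * a + sin (c * p.1)) ^+ 2 + (c * b - cos (c * p.1)) ^+ 2 =
      c ^+ 2 * (a ^+ 2 + b ^+ 2 + 2 * (r * D)) + 2 * (c * (1 - c * r) * D) +
      (cos (c * p.1) ^+ 2 + sin (c * p.1) ^+ 2) by rewrite /D; ring.
  rewrite sc -subr_gt0.
  have : c ^+ 2 * (a ^+ 2 + b ^+ 2 + 2 * (r * D)) < 0 by rewrite pmulr_rlt0// exprn_gt0.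
  have : c * (1 - c * r) * D <= 0.
    apply: mulr_ge0_le0; last exact: ltW.
    by apply: mulr_ge0; [exact: ltW|rewrite subr_ge0].
  lra.
have qE : c * p.1 + c * a = c * q.1 by rewrite /a; ring.
rewrite qE in aq lnq; split => //.
have -> : q.2 = b + (grim p.1 + c * t) by rewrite /b pE; ring.
suff : grim q.1 < b + grim p.1 by lra.
rewrite /grim -(ltr_pM2r c_gt0) mulrDl !divfK//; lra.
Qed.

Lemma boundary_grim t : boundary (traveling_set c strip grim t) = onGraph t.
Proof.
apply: boundary_traveling_set; [exact: open_strip| |exact: closed_grim].
move=> x sx; have [dx _] := is_derive_grim _ sx.
exact/differentiable_continuous/derivable1_diffP.
Qed.

(** Both tangent balls fit, so the terms 1 / (2 * r) cancel. *)
Lemma r_curvature_grim t p : onGraph t p ->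
  is_r_curvature r (traveling_set c strip grim t) p (c * cos (c * p.1)).
Proof.
move=> gp; have [sp pE] := gp; exists (normal p.1), (c * cos (c * p.1)); split.
- exact: outer_normal_grim.
- exact: curvature_grim.
rewrite /kappa_plus asboolT; last first.
  apply: (ext_ball_traveling_set c strip grim slope grim_tangent) => //=.
  - by rewrite sin_slope//; ring.
  - by rewrite oppr_lt0 acute_cos_gt0.
  - by rewrite /dot/= -[RHS](cos2Dsin2 (c * p.1)); ring.
rewrite /kappa_minus asboolT; last exact: int_ball_grim.
have r_neq0 : r != 0 by exact: lt0r_neq0.
by field.
Qed.

Lemma traveling_wave_grim : traveling_wave r c strip grim.
Proof.
split; [exact: open_strip|exact: is_interval_strip| |].
  exists 0; rewrite /strip/= /acute mulr0; have := @pi_gt0 R.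
  by move=> p0; apply/andP; split; lra.
(* the normal velocity, dot (0, c) (normal p.1) *)
exists (fun _ p => - (c * cos (c * p.1))) => t; rewrite boundary_grim; split.
- have c1 : continuous (fun p : plane R => c * p.1).
    by move=> p; apply: (cvg_comp _ _ (@cvg_fst _ _ _ _ _)); exact: continuous_dilation.
  apply: continuous_subspaceT => p; apply: cvgN; apply: cvgM; first exact: cvg_cst.
  by apply: (cvg_comp _ _ (c1 p)); exact: continuous_cos.
- move=> p gp; have [sp pE] := gp.
  rewrite -mulrN.
  apply: (normal_velocity_traveling c strip grim slope t p (normal p.1)) => //.
  + exact: boundary_grim.
  + exact: is_derive_grim.
  + by rewrite /= sin_slope//; ring.
  + exact: outer_normal_grim.
- by move=> p gp _; rewrite opprK; exact: r_curvature_grim.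
- move=> p gp; apply: subset_closure; split => //; have [sp pE] := gp.
  exists (0, -1), (drop_profile grim p.1); split.
    exact: (local_subgraph_epigraph strip grim open_strip).
  exact: (C2_drop_profile strip grim slope bend open_strip is_derive_grim
    is_derive_slope continuous_bend).
Qed.

Lemma C11_grim t : C11_boundary (traveling_set c strip grim t).
Proof.
move=> p; rewrite boundary_grim => -[sp pE].
exists (0, -1), (drop_profile grim p.1); split.
  exact: (local_subgraph_epigraph strip grim open_strip).
exact: (C11_drop_profile strip grim slope bend open_strip is_derive_grim
    is_derive_slope continuous_bend).
Qed.

Lemma convex_grim t :
  convex_set (traveling_set c strip grim t : set (convex_lmodType (plane R))).
Proof.
exact: (convex_traveling_set c strip grim slope grim_tangent t is_interval_strip).
Qed.

End GrimReaper.

Theorem theorem1p7 (R : realType) (r c : R) (r_gt0 : 0 < r) (r_le1 : r <= 1)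
    (c_gt0 : 0 < c) (c_lt_r : c < r) :
  exists (I : set R) (h : R -> R),
    traveling_wave r c I h /\
    forall t : R, C11_boundary (traveling_set c I h t) /\
                  convex_set (traveling_set c I h t : set (convex_lmodType (plane R))).
Proof.
have cr_le1 : c * r <= 1.
  by rewrite mulr_ile1// ?ltW// (lt_le_trans c_lt_r).
exists (strip c), (grim c); split; first exact: traveling_wave_grim.
by move=> t; split; [exact: C11_grim|exact: convex_grim].
Qed.
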